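(* Assume that $g$ is continuous, that the boundary value problem \[F(\nabla^2u,\nabla u,u,x)=0\ \text{ in }\Omega,\qquad u=g\ \text{ on }\partial\Omega\qquad(\mathrm{P})\] enjoys strong uniqueness, that the operators $F_n$ are monotone, proper, and consistent with $F$, that $\mathcal{X}_n$ is space filling, and that $\varepsilon_n\to0$ as $n\to\infty$. Let $u_n:\mathcal{X}_n\to\mathbb{R}$ be a sequence of solutions of \[F_n(u_n,u_n(x),x)=0\ \text{ if }x\in\mathcal{X}_n\cap\Omega_{\varepsilon_n},\qquad u_n(x)=g(x)\ \text{ if }x\in\mathcal{X}_n\cap\partial_{\varepsilon_n}\Omega,\] that is uniformly bounded, i.e. there is $C>0$ with $\max_{x\in\mathcal{X}_n}|u_n(x)|\le C$ for all $n\ge1$. Then \[\lim_{n\to\infty}\max_{x\in\mathcal{X}_n}|u_n(x)-u(x)|=0,\] where $u\in C(\overline\Omega)$ is the unique viscosity solution of $(\mathrm{P})$.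
   Context: $\Omega\subset\mathbb{R}^d$ is open and bounded. For each $n\ge1$, $\mathcal{X}_n\subset\Omega$ is a set of $n$ points, $L^2(\mathcal{X}_n)$ is the space of functions $\mathcal{X}_n\to\mathbb{R}$, and $F_n:L^2(\mathcal{X}_n)\times\mathbb{R}\times\mathcal{X}_n\to\mathbb{R}$. $(\varepsilon_n)$ is a sequence of positive numbers. For $r>0$, $\partial_r\Omega=\{x\in\Omega:\mathrm{dist}(x,\partial\Omega)\le r\}$, $\Omega_r=\Omega\setminus\partial_r\Omega$. $g:\overline\Omega\to\mathbb{R}$. $\mathbb{S}(d)$ is the space of real symmetric $d\times d$ matrices, and $F:\mathbb{S}(d)\times\mathbb{R}^d\times\mathbb{R}\times\overline\Omega\to\mathbb{R}$. Space filling: $\lim_{n\to\infty}\sup_{x\in\Omega}\mathrm{dist}(x,\mathcal{X}_n)=0$. Monotone: for all $n$, $u,v\in L^2(\mathcal{X}_n)$, $t\in\mathbb{R}$, $x\in\mathcal{X}_n$: $u\le v\Rightarrow F_n(u,t,x)\ge F_n(v,t,x)$. Proper: for all $n$, $u\in L^2(\mathcal{X}_n)$, $s,t\in\mathbb{R}$, $x\in\mathcal{X}_n$: $s\le t\Rightarrow F_n(u,s,x)\le F_n(u,t,x)$. Consistent with $F$: for every $\varphi\in C^\infty(\mathbb{R}^d)$ and every real sequence $\xi_n\to0$, \[\lim_{n\to\infty}\max_{x\in\mathcal{X}_n\cap\Omega_{\varepsilon_n}}\left|F_n(\varphi+\xi_n,\varphi(x)+\xi_n,x)-F(\nabla^2\varphi(x),\nabla\varphi(x),\varphi(x),x)\right|=0\]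 (where $\varphi$ is restricted to $\mathcal{X}_n$). Viscosity solutions: let $\mathrm{USC}(\overline\Omega)$, $\mathrm{LSC}(\overline\Omega)$ be the upper/lower semicontinuous real functions on $\overline\Omega$. $u\in\mathrm{USC}(\overline\Omega)$ is a viscosity subsolution of $(\mathrm{P})$ if for all $x\in\overline\Omega$ and every $\varphi\in C^\infty(\mathbb{R}^d)$ such that $u-\varphi$ has a local maximum at $x$ with respect to $\overline\Omega$: $F(\nabla^2\varphi(x),\nabla\varphi(x),u(x),x)\le0$ if $x\in\Omega$, and $\min\{F(\nabla^2\varphi(x),\nabla\varphi(x),u(x),x),\,u(x)-g(x)\}\le0$ if $x\in\partial\Omega$. $u\in\mathrm{LSC}(\overline\Omega)$ is a viscosity supersolution if for all $x\in\overline\Omega$ and every $\varphi\in C^\infty(\mathbb{R}^d)$ such that $u-\varphi$ has a local minimum at $x$ with respect to $\overline\Omega$: $F(\nabla^2\varphi(x),\nabla\varphi(x),u(x),x)\ge0$ if $x\in\Omega$, and $\max\{F(\nabla^2\varphi(x),\nabla\varphi(x),u(x),x),\,u(x)-g(x)\}\ge0$ if $x\in\partial\Omega$. A viscosity solution is both a sub- and a supersolution. Strong uniqueness: whenever $u\in\mathrm{USC}(\overline\Omega)$ is a viscosity subsolution and $v\in\mathrm{LSC}(\overline\Omega)$ is a viscosity supersolution of $(\mathrm{P})$, then $u\le v$ on $\overline\Omega$.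
   Formalization: F is additionally assumed jointly continuous on S(d)×R^d×R×closure(Ω); for arbitrary F the claim fails, e.g. Ω=(0,1), g=e^{-x}, F=x(p+r) inside and F=r−g on the boundary, where bounded solutions of a monotone, proper, consistent scheme tend to 0 inside instead of e^{-x}. *)

(* Defs.v *)
From HB Require Import structures.
From mathcomp Require Import all_boot all_order all_algebra finmap.
From mathcomp Require Import all_classical all_reals all_analysis.

Set Implicit Arguments.
Unset Strict Implicit.
Unset Printing Implicit Defensive.

Import Order.TTheory GRing.Theory Num.Theory.
Import numFieldNormedType.Exports.

Local Open Scope classical_set_scope.
Local Open Scope ring_scope.

Section EuclideanDistance.
Context {R : realType} {d : nat}.
Implicit Types (x y : 'rV[R]_d) (A Om : set 'rV[R]_d) (r : R).

(* The norm that the library puts on 'rV[R]_d is the sup norm.  It induces the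
   same topology (and the same bounded sets), but distances have to be measured
   with the Euclidean norm. *)
Definition edist x y : R := Num.sqrt (\sum_(i < d) (x 0 i - y 0 i) ^+ 2).

(* As a real infimum, this is only meaningful for nonempty A. *)
Definition edist_set x A : R := inf [set edist x y | y in A].

Definition boundary A : set 'rV[R]_d := closure A `\` A°.

Definition boundary_layer Om r : set 'rV[R]_d :=
  [set x | Om x /\ edist_set x (boundary Om) <= r].

Definition inner_domain Om r : set 'rV[R]_d := Om `\` boundary_layer Om r.

End EuclideanDistance.

Section SmoothFunctions.
Context {R : realType} {d : nat}.
Implicit Types (phi : 'rV[R]_d -> R) (x : 'rV[R]_d) (i j : 'I_d).

Definition partial i phi : 'rV[R]_d -> R := fun x => 'D_(delta_mx 0 i) phi x.

Definition iter_partial (s : seq 'I_d) phi : 'rV[R]_d -> R := foldr partial phi s.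

(* C^oo(R^d): the partial derivatives of all orders exist and are continuous. *)
Definition smooth phi : Prop :=
  forall s : seq 'I_d,
    continuous (iter_partial s phi) /\
    forall i x, derivable (iter_partial s phi) x (delta_mx 0 i).

Definition grad phi x : 'rV[R]_d := \row_i partial i phi x.

Definition hess phi x : 'M[R]_d := \matrix_(i, j) partial i (partial j phi) x.

End SmoothFunctions.

Section ViscositySolutions.
Context {R : realType} {d : nat}.
Implicit Types (u v w : 'rV[R]_d -> R) (K : set 'rV[R]_d).

(* A real function on K is represented by a function on 'rV[R]_d of which only
   the values on K are used. *)
Definition usc_on K u : Prop :=
  forall x, K x -> forall a, u x < a -> \forall y \near within K (nbhs x), u y < a.

Definition lsc_on K u : Prop :=
  forall x, K x -> forall a, a < u x -> \forall y \near within K (nbhs x), a < u y.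

Definition loc_max_on K w x : Prop :=
  \forall y \near within K (nbhs x), w y <= w x.

Definition loc_min_on K w x : Prop :=
  \forall y \near within K (nbhs x), w x <= w y.

(* Functions S(d) x R^d x R x closure Om -> R are represented likewise: only the
   values at symmetric matrices and at points of closure Om are used (Hessians
   of smooth functions are symmetric). *)
Definition operator := 'M[R]_d -> 'rV[R]_d -> R -> 'rV[R]_d -> R.

Variables (Om : set 'rV[R]_d) (F : operator) (g : 'rV[R]_d -> R).

(* Joint continuity of F up to the boundary.  The schemes are compared with F only
   in the interior, whereas (P) also evaluates F on the boundary: for
   F(p, r, x) = x (p + r) on (0, 1) and F(p, r, x) = r - g(x) on {0, 1}, with
   g(x) = exp(- x), strong uniqueness holds, but there are monotone, proper and
   consistent schemes with bounded solutions that tend to 0 in (0, 1), whereas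
   exp(- x) is the solution of (P). *)
Definition continuous_operator : Prop :=
  {within [set z : 'M[R]_d * 'rV[R]_d * R * 'rV[R]_d |
             (z.1.1.1^T = z.1.1.1)%R /\ closure Om z.2],
   continuous (fun z : 'M[R]_d * 'rV[R]_d * R * 'rV[R]_d =>
                 F z.1.1.1 z.1.1.2 z.1.2 z.2)}.

Definition visc_subsolution u : Prop :=
  usc_on (closure Om) u /\
  forall x (phi : 'rV[R]_d -> R), closure Om x -> smooth phi ->
    loc_max_on (closure Om) (fun y => u y - phi y) x ->
    (Om x -> F (hess phi x) (grad phi x) (u x) x <= 0) /\
    (boundary Om x ->
       Num.min (F (hess phi x) (grad phi x) (u x) x) (u x - g x) <= 0).

Definition visc_supersolution u : Prop :=
  lsc_on (closure Om) u /\
  forall x (phi : 'rV[R]_d -> R), closure Om x -> smooth phi ->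
    loc_min_on (closure Om) (fun y => u y - phi y) x ->
    (Om x -> 0 <= F (hess phi x) (grad phi x) (u x) x) /\
    (boundary Om x ->
       0 <= Num.max (F (hess phi x) (grad phi x) (u x) x) (u x - g x)).

Definition visc_solution u : Prop := visc_subsolution u /\ visc_supersolution u.

Definition strong_uniqueness : Prop :=
  forall u v, visc_subsolution u -> visc_supersolution v ->
    forall x, closure Om x -> u x <= v x.

End ViscositySolutions.

Section DiscreteOperators.
Context {R : realType} {d : nat}.

(* X : {fset 'rV[R]_d} is coerced to the finite type of its points, so the
   functions X_n -> R are the inhabitants of X n -> R. *)
Variable X : nat -> {fset 'rV[R]_d}.

(* Maximum over the points of X n lying in A of a nonnegative quantity; it is 0
   when there is no such point. *)
Definition max_on n (A : set 'rV[R]_d) (f : X n -> R) : R :=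
  \big[Num.max/0]_(x : X n | val x \in A) f x.

Definition space_filling (Om : set 'rV[R]_d) : Prop :=
  (fun n => sup [set edist_set x [set` X n] | x in Om]) @ \oo --> (0 : R).

Definition discrete_operator := forall n, (X n -> R) -> R -> X n -> R.

Variable Fn : discrete_operator.

Definition monotone_operator : Prop :=
  forall n (u v : X n -> R) t x,
    (forall y, u y <= v y) -> Fn v t x <= Fn u t x.

Definition proper_operator : Prop :=
  forall n (u : X n -> R) s t x, s <= t -> Fn u s x <= Fn u t x.

Definition consistent_with (Om : set 'rV[R]_d) (eps : nat -> R) (F : operator) : Prop :=
  forall (phi : 'rV[R]_d -> R) (xi : nat -> R),
    smooth phi -> xi @ \oo --> (0 : R) ->
    (fun n => @max_on n (inner_domain Om (eps n)) (fun x =>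
       `| Fn (fun y : X n => phi (val y) + xi n) (phi (val x) + xi n) x
          - F (hess phi (val x)) (grad phi (val x)) (phi (val x)) (val x) |))
      @ \oo --> (0 : R).

Definition discrete_solution (Om : set 'rV[R]_d) (g : 'rV[R]_d -> R)
    (eps : nat -> R) (u : forall n, X n -> R) : Prop :=
  forall n (x : X n),
    (inner_domain Om (eps n) (val x) -> Fn (u n) (u n x) x = 0) /\
    (boundary_layer Om (eps n) (val x) -> u n x = g (val x)).

End DiscreteOperators.

(* Main.v *)
(** This is the Barles-Souganidis half-relaxed limit argument. The upper relaxed
limit of the u_n is upper semicontinuous; it is a subsolution because a smooth psi
touching it strictly from above at x0 is, up to a constant xi_n -> 0, touched by u_n
from below at grid points tending to x0, where monotonicity and consistency transfer
the discrete equation to F, unless these points lie in the boundary layer, where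
u_n = g. The strict contact is obtained by adding a multiple of
sum_i (y_i - x0_i)^4, which changes neither the gradient nor the Hessian at x0.
The lower relaxed limit is a supersolution by the same argument applied to - u_n.
Strong uniqueness squeezes the two limits together, and a compactness argument turns
the equality into uniform convergence. Since F is only continuous on symmetric
matrices, the symmetry of the Hessian (Clairaut) is needed as well. *)

Require Import Defs.
From HB Require Import structures.
From mathcomp Require Import all_boot all_order all_algebra finmap.
From mathcomp Require Import all_classical all_reals all_analysis.
From mathcomp Require Import ring lra.

Set Implicit Arguments.
Unset Strict Implicit.
Unset Printing Implicit Defensive.

Import Order.TTheory GRing.Theory Num.Theory.
Import numFieldNormedType.Exports.

Local Open Scope classical_set_scope.
Local Open Scope ring_scope.

(** * Smooth functions *)

Section SmoothCalculus.
Context {R : realType} {d : nat}.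
Implicit Types (f g : 'rV[R]_d -> R) (x y v : 'rV[R]_d) (i j : 'I_d) (s : seq 'I_d).

Lemma iter_partial_rcons s i f :
  iter_partial (rcons s i) f = iter_partial s (partial i f).
Proof. by rewrite /iter_partial foldr_rcons. Qed.

Lemma smooth_continuous f : smooth f -> continuous f.
Proof. by move=> /(_ [::]) []. Qed.

Lemma smooth_derivable f i x : smooth f -> derivable f x (delta_mx 0 i).
Proof. by move=> /(_ [::]) []. Qed.

Lemma smooth_partial f i : smooth f -> smooth (partial i f).
Proof. by move=> sf s; rewrite -iter_partial_rcons; exact: sf. Qed.

Lemma partialN i f : smooth f -> partial i (fun y => - f y) = (fun y => - partial i f y).
Proof. by move=> sf; apply/funext => x; have := deriveN (@smooth_derivable f i x sf); exact. Qed.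

Lemma partialD i f g : smooth f -> smooth g ->
  partial i (fun y => f y + g y) = (fun y => partial i f y + partial i g y).
Proof.
move=> sf sg; apply/funext => x.
by have := deriveD (@smooth_derivable f i x sf) (@smooth_derivable g i x sg); exact.
Qed.

Lemma smooth_iter_partial f s : smooth f -> smooth (iter_partial s f).
Proof. move=> sf; elim: s => [|i s]; [exact: sf|exact: smooth_partial]. Qed.

Lemma iter_partialN s f : smooth f ->
  iter_partial s (fun y => - f y) = (fun y => - iter_partial s f y).
Proof.
move=> sf; elim: s => [|i s /= ->]; first by [].
exact/partialN/smooth_iter_partial.
Qed.

Lemma iter_partialD s f g : smooth f -> smooth g ->
  iter_partial s (fun y => f y + g y) =
  (fun y => iter_partial s f y + iter_partial s g y).
Proof.
move=> sf sg; elim: s => [|i s /= ->]; first by [].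
by apply: partialD; exact: smooth_iter_partial.
Qed.

Lemma smoothN f : smooth f -> smooth (fun y => - f y).
Proof.
move=> sf s; rewrite (iter_partialN _ sf); have [cf df] := sf s; split.
  by move=> x; exact: (cvgN (cf x)).
by move=> i x; exact: (derivableN (df i x)).
Qed.

Lemma smoothD f g : smooth f -> smooth g -> smooth (fun y => f y + g y).
Proof.
move=> sf sg s; rewrite (iter_partialD _ sf sg).
have [[cf df] [cg dg]] := (sf s, sg s); split.
  by move=> x; exact: (cvgD (cf x) (cg x)).
by move=> i x; exact: (derivableD (df i x) (dg i x)).
Qed.

Lemma hessE f x i j : hess f x i j = partial i (partial j f) x.
Proof. by rewrite mxE. Qed.

Lemma gradN f x : smooth f -> grad (fun y => - f y) x = - grad f x.
Proof. by move=> sf; apply/rowP => i; rewrite !mxE (partialN _ sf). Qed.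

Lemma gradD f g x : smooth f -> smooth g ->
  grad (fun y => f y + g y) x = grad f x + grad g x.
Proof. by move=> sf sg; apply/rowP => i; rewrite !mxE (partialD _ sf sg). Qed.

Lemma hessN f x : smooth f -> hess (fun y => - f y) x = - hess f x.
Proof.
move=> sf; apply/matrixP => i j; rewrite !mxE (partialN _ sf).
by rewrite (partialN _ (smooth_partial _ sf)).
Qed.

Lemma hessD f g x : smooth f -> smooth g ->
  hess (fun y => f y + g y) x = hess f x + hess g x.
Proof.
move=> sf sg; apply/matrixP => i j; rewrite [LHS]mxE. rewrite (partialD j sf sg).
rewrite (partialD i (smooth_partial j sf) (smooth_partial j sg)).
by rewrite [RHS]mxE; congr (_ + _); exact: (esym (hessE _ _ _ _)).
Qed.

(** A family closed under partial derivatives. For exponent 0 the factor [*+ k] kills the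
    coefficient, so the truncated predecessor [k.-1] is harmless. *)
Definition coord_monomial (i : 'I_d) (a c : R) (k : nat) : 'rV[R]_d -> R :=
  fun y => a * (y 0 i - c) ^+ k.

Lemma is_derive_coord_monomial i j a c k x :
  is_derive x (delta_mx 0 j) (coord_monomial i a c k)
    (coord_monomial i (a * (i == j)%:R *+ k) c k.-1 x).
Proof.
have dlin : is_derive x (delta_mx 0 j : 'rV[R]_d) (fun y : 'rV[R]_d => y 0 i)
    (i == j)%:R.
  apply: DeriveDef; first exact/diff_derivable/differentiable_coord.
  rewrite /derive; apply: cvg_lim => //; apply: cvg_near_cst.
  near=> h; rewrite /= !mxE addrK eqxx /= eq_sym /GRing.scale /= mulKf //.
  near: h; exact: nbhs_dnbhs_neq.
have -> : coord_monomial i a c k = a *: (((fun y : 'rV[R]_d => y 0 i) - cst c) ^+ k).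
  by apply/funext => y; rewrite /coord_monomial /= exprfctE.
apply: is_derive_eq.
rewrite subr0 /coord_monomial [in RHS]mulrnAl.
have -> : ((fun y : 'rV[R]_d => y 0 i) - cst c) x = x 0 i - c by [].
rewrite -[RHS]mulr_natl; move: (_ ^+ _) (i == j)%:R (k%:R) => p b m.
change (a * (m * p * b) = m * (a * b * p)).
by rewrite -[m * p * b]mulrA [p * b]mulrC mulrCA !mulrA.
Unshelve. all: by end_near. Qed.

Lemma partial_coord_monomial i j a c k :
  partial j (coord_monomial i a c k) = coord_monomial i (a * (i == j)%:R *+ k) c k.-1.
Proof.
by apply/funext => x; have [_] := is_derive_coord_monomial i j a c k x.
Qed.

Lemma coord_monomial_continuous i a c k : continuous (coord_monomial i a c k).
Proof.
move=> x; suff h : {for x, continuous (fun y : 'rV[R]_d => (y 0 i - c) ^+ k)}.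
  exact: (cvgM (cvg_cst a) h).
apply: (@continuous_comp _ _ _ (fun y : 'rV[R]_d => y 0 i - c) (fun t => t ^+ k)).
  exact: (cvgB (differentiable_continuous (differentiable_coord x 0 i)) (cvg_cst c)).
exact: exprn_continuous.
Qed.

(** Every iterated partial derivative stays in the family, with only the coefficient and the
    exponent changing. *)
Lemma smooth_coord_monomial i a c k : smooth (coord_monomial i a c k).
Proof.
move=> s; have [b [m ->]] : exists b m,
    iter_partial s (coord_monomial i a c k) = coord_monomial i b c m.
  elim: s => [|j s [b [m IH]]] /=; first by exists a, k.
  by rewrite IH partial_coord_monomial; eexists; eexists.
split; first exact: coord_monomial_continuous.
by move=> j x; have [] := is_derive_coord_monomial i j b c m x.
Qed.

Lemma smooth_cst (c : R) : smooth (fun _ : 'rV[R]_d => c).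
Proof.
move=> s; have [b ->] : exists b : R,
    iter_partial s (fun _ : 'rV[R]_d => c) = (fun _ => b).
  elim: s => [|j s [b IH]] /=; first by exists c.
  by rewrite IH; exists 0; apply/funext => x; exact: derive_cst.
by split => [|i x]; [exact: (@cst_continuous _ _ b)|exact: derivable_cst].
Qed.


(** * Symmetry of second derivatives *)

Lemma is_derive_line f v x (t : R) : derivable f (t *: v + x) v ->
  is_derive t 1 (fun r => f (r *: v + x)) ('D_v f (t *: v + x)).
Proof.
have eqq : (fun h : R => h^-1 *: (((fun r => f (r *: v + x)) \o shift t) (h *: 1) -
     f (t *: v + x))) =
   (fun h => h^-1 *: ((f \o shift (t *: v + x)) (h *: v) - f (t *: v + x))).
  by apply/funext => h /=; rewrite scalerDl addrA [_%:A]mulr1.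
by move=> df; apply: DeriveDef; rewrite /derivable /derive eqq.
Qed.

Lemma is_derive_translate f v c x : derivable f (x + c) v ->
  is_derive x v (fun y => f (y + c)) ('D_v f (x + c)).
Proof.
have eqq : (fun h : R => h^-1 *: (((fun y => f (y + c)) \o shift x) (h *: v) -
     f (x + c))) =
   (fun h => h^-1 *: ((f \o shift (x + c)) (h *: v) - f (x + c))).
  by apply/funext => h /=; rewrite addrA.
by move=> df; apply: DeriveDef; rewrite /derivable /derive eqq.
Qed.

Lemma line_MVT f v x (h : R) : 0 < h -> (forall y, derivable f y v) ->
  exists2 t, 0 < t < h & f (h *: v + x) - f x = h * 'D_v f (t *: v + x).
Proof.
move=> h0 df.
have dl (t : R) : is_derive t 1 (fun r : R => f (r *: v + x)) ('D_v f (t *: v + x)).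
  exact: is_derive_line.
have [|t] := @MVT R (fun r => f (r *: v + x)) (fun r => 'D_v f (r *: v + x)) 0 h h0.
  by apply: derivable_within_continuous => t _; exact: ex_derive.
by rewrite in_itv /= => t0h; rewrite scale0r add0r subr0 mulrC => ->; exists t.
Qed.

(* Two applications of the mean value theorem to the second difference. *)
Lemma second_difference f i j x (h : R) : smooth f -> 0 < h ->
  exists s t : R, [/\ 0 < s < h, 0 < t < h &
    f (h *: delta_mx 0 i + (h *: delta_mx 0 j + x)) - f (h *: delta_mx 0 i + x)
      - f (h *: delta_mx 0 j + x) + f x
    = h ^+ 2 * partial j (partial i f) (t *: delta_mx 0 j + (s *: delta_mx 0 i + x))].
Proof.
move=> sf h0; pose G y := f (y + h *: delta_mx 0 j) - f y.
have dG y : is_derive y (delta_mx 0 i) G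
    (partial i f (y + h *: delta_mx 0 j) - partial i f y).
  apply: is_deriveB; last exact/derivableP/smooth_derivable.
  by apply: is_derive_translate; exact: smooth_derivable.
have [y|s s0h] := @line_MVT G (delta_mx 0 i) x h h0; first exact: ex_derive.
rewrite derive_val => Gs.
have [y|t t0h Ht] := @line_MVT (partial i f) (delta_mx 0 j) (s *: delta_mx 0 i + x) h h0.
  by apply: smooth_derivable; exact: smooth_partial.
exists s, t; split => //.
move: Gs; rewrite [_ + h *: delta_mx 0 j]addrC Ht /G => Gs.
rewrite expr2 -mulrA -Gs.
rewrite -[h *: delta_mx 0 i + x + _]addrA [x + h *: _]addrC; ring.
Qed.

(** Near [x] both functions are within [e / 2] of their values there, and some value of [A] near [x]
    is also a value of [B] near [x]; hence [A x] and [B x] differ by at most [e]. *)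
Lemma continuous_coincidence (A B : 'rV[R]_d -> R) x (c : R) :
  {for x, continuous A} -> {for x, continuous B} -> 0 <= c ->
  (forall h : R, 0 < h -> exists p q, [/\ A p = B q, `|x - p| <= h * c & `|x - q| <= h * c]) ->
  A x = B x.
Proof.
move=> cA cB c0 near_eq.
apply/eqP; rewrite -subr_eq0 -normr_eq0; apply/eqP.
apply/le_anti; rewrite normr_ge0 andbT; apply/ler_addgt0Pr => e e0; rewrite add0r.
have e2 : 0 < e / 2 by rewrite divr_gt0.
have /cvgrPdist_lt/(_ _ e2)/nbhs_ballP[r /= r0 HA] := cA.
have /cvgrPdist_lt/(_ _ e2)/nbhs_ballP[r' /= r'0 HB] := cB.
pose m := Num.min r r'.
have m0 : 0 < m by rewrite lt_min r0 r'0.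
have c1 : 0 < c + 1 by rewrite ltr_wpDl.
(* The denominator [c + 1] keeps [h * c] below [m] and is nonzero even if [c = 0]. *)
have [|p [q [AB xp xq]]] := near_eq (m / (c + 1)); first by rewrite divr_gt0.
have mD : m / (c + 1) * c < m by rewrite mulrAC ltr_pdivrMr // ltr_pM2l // ltrDl.
have pr : ball x r p.
  by rewrite -ball_normE /=; apply: le_lt_trans xp _; rewrite (lt_le_trans mD) // ge_min lexx.
have qr : ball x r' q.
  rewrite -ball_normE /=; apply: le_lt_trans xq _.
  by rewrite (lt_le_trans mD) // ge_min lexx orbT.
have := HA p pr; have := HB q qr; rewrite /= AB => H1 H2.
rewrite (splitr e) -(subrKA (B q)) (le_trans (ler_normD _ _)) // lerD //; first exact: ltW.
by rewrite distrC ltW.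
Qed.

(** The second difference is symmetric in [i] and [j], and it equals [h ^+ 2] times either mixed
    derivative at a point whose distance to [x] is of order [h]. Continuity lets [h] tend to 0. *)
Lemma hess_sym f x : smooth f -> (hess f x)^T = hess f x.
Proof.
move=> sf; apply/matrixP => i j; rewrite [LHS]mxE !hessE.
set A := partial j (partial i f); set B := partial i (partial j f).
have cA : continuous A.
  exact: smooth_continuous (smooth_partial j (smooth_partial i sf)).
have cB : continuous B.
  exact: smooth_continuous (smooth_partial i (smooth_partial j sf)).
have near_eq h : 0 < h -> exists p q, [/\ A p = B q,
    `|x - p| <= h * (`|delta_mx 0 i : 'rV[R]_d| + `|delta_mx 0 j : 'rV[R]_d|) &
    `|x - q| <= h * (`|delta_mx 0 i : 'rV[R]_d| + `|delta_mx 0 j : 'rV[R]_d|)].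
  move=> h0.
  have [s [t [sh th E1]]] := second_difference i j x sf h0.
  have [s' [t' [sh' th' E2]]] := second_difference j i x sf h0.
  have bnd (k l : 'I_d) (r r' : R) : 0 < r < h -> 0 < r' < h ->
     `|x - (r *: delta_mx 0 k + (r' *: delta_mx 0 l + x))| <=
      h * (`|delta_mx 0 k : 'rV[R]_d| + `|delta_mx 0 l : 'rV[R]_d|).
    move=> /andP[r0 rh] /andP[r'0 r'h].
    rewrite distrC addrA addrK mulrDr (le_trans (ler_normD _ _)) // !normrZ.
    by rewrite !gtr0_norm // lerD // ler_wpM2r // ltW.
  exists (t *: delta_mx 0 j + (s *: delta_mx 0 i + x)),
    (t' *: delta_mx 0 i + (s' *: delta_mx 0 j + x)); split; last exact: bnd.
    apply: (@mulfI _ (h ^+ 2)); first by rewrite expf_neq0 // gt_eqF.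
    apply: (etrans (esym E1)); apply: etrans E2.
    by rewrite [h *: delta_mx 0 i + (h *: delta_mx 0 j + x)]addrCA; ring.
  by rewrite [X in _ * X]addrC; exact: bnd.
apply: continuous_coincidence near_eq; [exact: cA|exact: cB|exact: addr_ge0].
Qed.

End SmoothCalculus.

(** * Upper relaxed limits *)

Lemma dist_exp_continuous (R : realType) (V : normedModType R) (x0 : V) k :
  continuous (fun y => `|x0 - y| ^+ k).
Proof.
move=> x; apply: (@continuous_comp _ _ _ (fun y => `|x0 - y|) (fun t => t ^+ k)).
  by apply: cvg_norm; apply: cvgB; [exact: cvg_cst|exact: cvg_id].
exact: exprn_continuous.
Qed.

Section RelaxedLimit.
Context {R : realType} {d : nat} (X : nat -> {fset 'rV[R]_d}).
Implicit Types (u : forall n, X n -> R) (x y : 'rV[R]_d) (a : R).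

(** Quantifying over all [y] near [x], with grid points singled out by [val z = y], makes this a
    statement about a product filter, as the near-covering form of compactness requires. *)
Definition eventual_upper_bound u x : set R :=
  [set a | \forall y \near x & n \near \oo,
     forall z : X n, val z = y -> u n z <= a].

(* limsup of u n z as n -> oo and z -> x, z in X n *)
Definition upper_limit u x : R := inf (eventual_upper_bound u x).

(** Rules out points without late grid points nearby, where every real would be an eventual upper
    bound and the infimum would be meaningless. *)
Definition dense_in_limit (K : set 'rV[R]_d) : Prop :=
  forall x, K x -> forall U, nbhs x U -> \forall n \near \oo, exists z : X n, U (val z).

Variables (K : set 'rV[R]_d) (u : forall n, X n -> R) (C : R).
Hypothesis X_dense : dense_in_limit K.
Hypothesis u_bounded : forall n (z : X n), `|u z| <= C.

(** By density the neighbourhood contains a grid point at a late time, and its value lies between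
    [- C] and [a]. *)
Lemma eventual_upper_bound_ge x a : K x -> eventual_upper_bound u x a -> - C <= a.
Proof.
move=> Kx [[U V] /= [Ux [N _ NV]] UV].
have [M _ HM] := X_dense Kx Ux.
have [z Uz] := HM (maxn N M) (leq_maxr _ _).
apply: (@le_trans _ _ (u z)).
  by have := u_bounded z; rewrite ler_norml => /andP[].
by apply: (UV (val z, maxn N M)) => //; split => //; exact/NV/leq_maxl.
Qed.

Lemma eventual_upper_bound_cst x : eventual_upper_bound u x C.
Proof.
exists (setT, setT) => /=; first by split; exact: filterT.
move=> -[y n] _ z _ /=.
by have := u_bounded z; rewrite ler_norml => /andP[].
Qed.

Lemma eventual_upper_bound_has_inf x : K x -> has_inf (eventual_upper_bound u x).
Proof.
move=> Kx; split; first by exists C; exact: eventual_upper_bound_cst.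
by exists (- C) => a; exact: eventual_upper_bound_ge.
Qed.

Lemma upper_limit_lt x a : K x -> upper_limit u x < a -> eventual_upper_bound u x a.
Proof.
move=> Kx /(inf_lt (eventual_upper_bound_has_inf Kx).1) [b [[U V] /= UVx UV] ba].
exists (U, V) => // -[y n] /= Uyn z zy.
by rewrite (le_trans (UV (y, n) Uyn z zy)) // ltW.
Qed.

Lemma upper_limit_le x a : K x -> eventual_upper_bound u x a -> upper_limit u x <= a.
Proof. by move=> Kx; apply: ge_inf; have [] := eventual_upper_bound_has_inf Kx. Qed.

Lemma upper_limit_gt x a U N : K x -> a < upper_limit u x -> nbhs x U ->
  exists n (z : X n), [/\ (N <= n)%N, U (val z) & a < u z].
Proof.
move=> Kx ax Ux; apply: contrapT => H.
suff : upper_limit u x <= a by rewrite leNgt ax.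
apply: upper_limit_le => //; exists (U, [set n | (N <= n)%N]).
  by split => //; exists N.
move=> [y n] /= [Uy Nn] z zy; rewrite leNgt; apply/negP => az.
by apply: H; exists n, z; split => //; move: Uy; rewrite -zy.
Qed.

Lemma upper_limit_bounded x : K x -> `|upper_limit u x| <= C.
Proof.
move=> Kx; rewrite ler_norml; apply/andP; split.
  apply: lb_le_inf; first by exists C; exact: eventual_upper_bound_cst.
  by move=> a; exact: eventual_upper_bound_ge.
exact: upper_limit_le (eventual_upper_bound_cst _).
Qed.

(** A neighbourhood of [x] on which a bound [b < a] holds is also a neighbourhood of each point near
    [x], so [b] bounds the upper limit there too. *)
Lemma upper_limit_usc : usc_on K (upper_limit u).
Proof.
move=> x Kx a /(inf_lt (eventual_upper_bound_has_inf Kx).1) [b [[U V] /= [Ux V1] UV] ba].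
rewrite near_withinE; near=> y => Ky; apply: le_lt_trans ba; apply: upper_limit_le => //.
exists (U, V) => //=; split => //; near: y; exact: (near_join Ux).
Unshelve. all: by end_near. Qed.

(** The strict inequality holds for grid points near each [x] from some rank on; compactness of [K]
    makes the rank uniform. *)
Lemma upper_limit_lt_uniform (psi : 'rV[R]_d -> R) : compact K ->
  (forall n (z : X n), K (val z)) -> lsc_on K psi ->
  (forall x, K x -> upper_limit u x < psi x) ->
  \forall n \near \oo, forall z : X n, u z < psi (val z).
Proof.
move=> cK XK lpsi ltpsi.
have cov : \forall n \near \oo, K `<=` (fun y => forall z : X n, val z = y -> u z < psi y).
  move/compact_near_coveringP/near_covering_withinP : cK; apply => x Kx.
  (* The midpoint separates the two sides: near [x], the values of [u] stay below it and [psi] stays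
     above it. *)
  pose m := (upper_limit u x + psi x) / 2.
  have xm : upper_limit u x < m by rewrite /m midf_lt // ltpsi.
  have mx : m < psi x by rewrite /m midf_lt // ltpsi.
  have [[U V] /= [Ux Voo] UV] := upper_limit_lt Kx xm.
  exists (U `&` [set y | K y -> m < psi y], V) => /=.
    by split => //; apply: filterI => //; exact: lpsi.
  move=> [y n] /= [[Uy my] Vn] Ky z zy; apply: le_lt_trans (my Ky).
  by apply: (UV (y, n)).
by apply: filterS cov => n Hn z; exact: Hn (XK n z) z erefl.
Qed.

(* The perturbation |x0 - y|^4 localises the maximum points of u n - psi. *)
Lemma maximum_points_cvg (psi : 'rV[R]_d -> R) x0 : compact K ->
  (forall n (z : X n), K (val z)) -> continuous psi -> K x0 ->
  upper_limit u x0 = psi x0 ->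
  (forall y, K y -> upper_limit u y <= psi y - `|x0 - y| ^+ 4) ->
  forall (delta : R) N, 0 < delta ->
  exists n (z : X n), [/\ (N <= n)%N, `|x0 - val z| < delta,
    `|u z - psi (val z)| < delta &
    forall y : X n, u y <= psi (val y) + (u z - psi (val z))].
Proof.
move=> cK XK cpsi Kx0 x0psi ltpsi delta N d0.
(* Chosen so that both [eta < delta] and [2 * eta <= delta ^+ 4]. *)
pose eta : R := Num.min delta (delta ^+ 4) / 2.
have eta0 : 0 < eta by rewrite divr_gt0 // lt_min d0 exprn_gt0.
have eta_delta : eta < delta.
  rewrite /eta ltr_pdivrMr // (@le_lt_trans _ _ delta) // ?ge_min ?lexx //.
  by rewrite ltr_pMr // ltr1n.
have eta_delta4 : eta *+ 2 <= delta ^+ 4.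
  by rewrite -mulr_natr /eta divfK // ge_min lexx orbT.
have [M _ HM] : \forall n \near \oo, forall z : X n,
    u z < psi (val z) - `|x0 - val z| ^+ 4 + eta.
  apply: (@upper_limit_lt_uniform (fun y => psi y - `|x0 - y| ^+ 4 + eta)) => //.
    move=> x Kx a ax; apply: cvg_within.
    have cont : {for x, continuous (fun y => psi y - `|x0 - y| ^+ 4 + eta)}.
      have cn : {for x, continuous (fun y : 'rV[R]_d => `|x0 - y| ^+ 4)}.
        exact: dist_exp_continuous.
      exact: (cvgD (cvgB (cpsi x) cn) (cvg_cst eta)).
    exact: (cvgr_gt _ cont).
  by move=> y Ky; rewrite (le_lt_trans (ltpsi y Ky)) // ltrDl.
have psinear : \forall y \near x0, psi y < psi x0 + eta / 2.
  by apply: (cvgr_lt _ (cpsi x0)); rewrite ltrDl divr_gt0.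
(* The two errors [eta / 2] add up: [u - psi] exceeds [- eta] at [z0], hence also at its maximum
   point. *)
have [|n [z0 [Nn psiz0 uz0]]] :=
  @upper_limit_gt x0 (psi x0 - eta / 2) _ (maxn N M) Kx0 _ psinear.
  by rewrite x0psi ltrBlDr ltrDl divr_gt0.
pose f (z : X n) := u z - psi (val z).
pose z : X n := [arg max_(i > z0) f i]%O.
have zmax (y : X n) : f y <= f z by rewrite /z; case: arg_maxP => // i _; apply.
have z_lb : - eta < f z.
  by apply: lt_le_trans (zmax z0); rewrite /f; move: psiz0 uz0 => /=; lra.
have z_ub : f z < eta - `|x0 - val z| ^+ 4.
  have := HM n (leq_trans (leq_maxr _ _) Nn) z; rewrite /f; lra.
(* The maximum lies between [- eta] and [eta] minus the fourth power, so that power is below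
   [2 * eta]. *)
have norm4 : `|x0 - val z| ^+ 4 < delta ^+ 4.
  by move: z_lb z_ub eta_delta4; rewrite mulr2n; lra.
exists n, z; split.
- exact: leq_trans (leq_maxl _ _) Nn.
- by rewrite -(@ltr_pXn2r _ 4) ?nnegrE // ltW.
- rewrite ltr_norml; have : 0 <= `|x0 - val z| ^+ 4 by rewrite exprn_ge0.
  by move: z_lb z_ub; rewrite -/(f z); lra.
- by move=> y; move: (zmax y); rewrite /f; lra.
Qed.

End RelaxedLimit.

(** * Test functions and consistency *)

Section TestFunctions.
Context {R : realType} {d : nat}.
Implicit Types (x y : 'rV[R]_d) (phi psi : 'rV[R]_d -> R).

Lemma grad_cst (c : R) x : grad (fun=> c) x = 0.
Proof. by apply/rowP => i; rewrite !mxE; exact: derive_cst. Qed.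

Lemma hess_cst (c : R) x : hess (fun=> c) x = 0.
Proof.
apply/matrixP => i j; rewrite hessE mxE (_ : partial j _ = fun=> 0).
  exact: derive_cst.
by apply/funext => y; exact: derive_cst.
Qed.

(** A smooth substitute for the fourth power of the sup norm. The list of coordinates is a parameter
    so that derivatives can be computed by induction on it. *)
Definition quartic (s : seq 'I_d) (k : R) x0 : 'rV[R]_d -> R :=
  fun y => \sum_(i <- s) coord_monomial i k (x0 0 i) 4 y.

Lemma smooth_quartic s k x0 : smooth (quartic s k x0).
Proof.
elim: s => [|i s IH].
  rewrite (_ : quartic _ _ _ = fun=> 0); first exact: smooth_cst.
  by apply/funext => y; rewrite /quartic big_nil.
rewrite (_ : quartic _ _ _ = fun y => coord_monomial i k (x0 0 i) 4 y + quartic s k x0 y).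
  exact: smoothD (smooth_coord_monomial _ _ _ _) IH.
by apply/funext => y; rewrite /quartic big_cons.
Qed.

Lemma grad_quartic s k x0 : grad (quartic s k x0) x0 = 0.
Proof.
elim: s => [|i s IH].
  rewrite (_ : quartic _ _ _ = fun=> 0); first exact: grad_cst.
  by apply/funext => y; rewrite /quartic big_nil.
rewrite (_ : quartic _ _ _ = fun y => coord_monomial i k (x0 0 i) 4 y + quartic s k x0 y).
  rewrite (gradD _ (smooth_coord_monomial _ _ _ _) (smooth_quartic _ _ _)) IH addr0.
  apply/rowP => j; rewrite !mxE partial_coord_monomial /coord_monomial.
  by rewrite subrr expr0n mulr0.
by apply/funext => y; rewrite /quartic big_cons.
Qed.

Lemma hess_quartic s k x0 : hess (quartic s k x0) x0 = 0.
Proof.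
elim: s => [|i s IH].
  rewrite (_ : quartic _ _ _ = fun=> 0); first exact: hess_cst.
  by apply/funext => y; rewrite /quartic big_nil.
rewrite (_ : quartic _ _ _ = fun y => coord_monomial i k (x0 0 i) 4 y + quartic s k x0 y).
  rewrite (hessD _ (smooth_coord_monomial _ _ _ _) (smooth_quartic _ _ _)) IH addr0.
  apply/matrixP => j l; rewrite hessE mxE !partial_coord_monomial /coord_monomial.
  by rewrite subrr expr0n mulr0.
by apply/funext => y; rewrite /quartic big_cons.
Qed.

(** The sup norm is attained at one coordinate, and the other terms of the sum are nonnegative. *)
Lemma quartic_ge k x0 y : 0 <= k ->
  k * `|x0 - y| ^+ 4 <= quartic (index_enum 'I_d) k x0 y.
Proof.
move=> k0; have term0 i : 0 <= coord_monomial i k (x0 0 i) 4 y.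
  by rewrite mulr_ge0 // -[4%N]/(2 * 2)%N exprM exprn_ge0 // sqr_ge0.
have E : `|x0 - y| = mx_norm (x0 - y) by [].
have [nz|nz] := eqVneq (mx_norm (x0 - y)) 0.
  by rewrite E nz expr0n mulr0 sumr_ge0.
have [[l i] /= xyi] := mx_norm_neq0 nz; rewrite E xyi.
rewrite !mxE /quartic (bigD1 i) //= ler_wpDr ?sumr_ge0 //.
rewrite /coord_monomial (ord1 l) distrC.
by rewrite -[4%N]/(2 * 2)%N !exprM real_normK ?num_real.
Qed.

(* A test function touching w from above locally is modified to one that touches
   it globally, without changing its derivatives at the touching point. *)
Lemma global_test_function (K : set 'rV[R]_d) (w phi : 'rV[R]_d -> R) x0 (C : R) :
  compact K -> K x0 -> (forall y, K y -> `|w y| <= C) -> smooth phi ->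
  loc_max_on K (fun y => w y - phi y) x0 ->
  exists psi, [/\ smooth psi, psi x0 = w x0, grad psi x0 = grad phi x0,
    hess psi x0 = hess phi x0 &
    forall y, K y -> w y <= psi y - `|x0 - y| ^+ 4].
Proof.
move=> cK Kx0 wC sphi locmax.
have [M phiM] : exists M, forall y, K y -> `|phi y| <= M.
  have K0 : K !=set0 by exists x0.
  have cphi : {within K, continuous phi}.
    by apply: continuous_subspaceT; exact: smooth_continuous.
  have [a Ka amax] := compact_EVT_max K0 cK cphi.
  have [b Kb bmin] := compact_EVT_min K0 cK cphi.
  exists (`|phi a| + `|phi b|) => y Ky; rewrite ler_norml.
  have /(_ y) := amax; rewrite inE => /(_ Ky) ya.
  have /(_ y) := bmin; rewrite inE => /(_ Ky) yb.
  have := ler_norm (phi a); have := ler_norm (- phi b); rewrite normrN.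
  by have := normr_ge0 (phi a); have := normr_ge0 (phi b); lra.
have [r /= r0 ball_max] : exists2 r : R, 0 < r & forall y, `|x0 - y| < r -> K y ->
    w y - phi y <= w x0 - phi x0.
  have /nbhs_ballP[r r0 H] := locmax; exists r => // y xy Ky.
  by apply: H => //; rewrite -ball_normE.
have C0 : 0 <= C by apply: le_trans (wC _ Kx0).
have M0 : 0 <= M by apply: le_trans (phiM _ Kx0).
have r4 : 0 < r ^+ 4 by rewrite exprn_gt0.
(* Outside the ball of radius [r] the quotient absorbs the variation of [w - phi], at most
   [2 * C + 2 * M]; the summand 1 leaves room for the fourth power everywhere. *)
pose k := (2 * C + 2 * M) / r ^+ 4 + 1.
have k1 : 1 <= k by rewrite lerDr; apply: divr_ge0; [lra|exact: ltW].
have k0 : 0 <= k by rewrite (le_trans _ k1).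
pose q := quartic (index_enum 'I_d) k x0.
pose psi y := phi y + (q y + (w x0 - phi x0)).
have sc := @smooth_cst R d (w x0 - phi x0).
have sq := smooth_quartic (index_enum 'I_d) k x0.
have sqc := smoothD sq sc.
have qx0 : q x0 = 0.
  by rewrite /q /quartic big1 // => i _; rewrite /coord_monomial subrr expr0n mulr0.
exists psi; split.
- exact: smoothD.
- by rewrite /psi qx0; ring.
- rewrite /psi (gradD _ sphi sqc) (gradD _ sq sc) grad_quartic add0r.
  by rewrite grad_cst addr0.
- rewrite /psi (hessD _ sphi sqc) (hessD _ sq sc) hess_quartic add0r.
  by rewrite hess_cst addr0.
- move=> y Ky; have qy := quartic_ge x0 y k0; rewrite -/q in qy.
  set t := `|x0 - y| ^+ 4 in qy *.
  have t0 : 0 <= t by rewrite exprn_ge0.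
  have [xy|xy] := ltP `|x0 - y| r.
    have := ball_max y xy Ky; have : t <= k * t by rewrite ler_peMl.
    by move: qy; rewrite /psi; lra.
  have rt : r ^+ 4 <= t by rewrite lerXn2r // nnegrE // ltW.
  have kt : 2 * C + 2 * M + t <= k * t.
    rewrite /k [leRHS]mulrDl mul1r lerD2r [leRHS]mulrAC ler_pdivlMr //.
    by rewrite ler_wpM2l //; lra.
  have := wC y Ky; have := wC x0 Kx0; have := phiM y Ky; have := phiM x0 Kx0.
  rewrite !ler_norml => /andP[? ?] /andP[? ?] /andP[? ?] /andP[? ?].
  by move: qy kt; rewrite /psi; lra.
Qed.

End TestFunctions.

Lemma matrix_continuous_at (R : realType) (T : topologicalType) m n
  (f : T -> 'M[R]_(m, n)) (x : T) :
  (forall i j, {for x, continuous (fun y => f y i j)}) -> {for x, continuous f}.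
Proof.
move=> cf P /= [Q Qnb QP].
have : \forall y \near x, forall i j, Q i j (f y i j).
  by apply: filter_forall => i; apply: filter_forall => j; exact: cf.
by apply: filterS => y Qy; exact: QP.
Qed.

(** * Consistency, uniformly for small constant shifts *)

Section Consistency.
Context {R : realType} {d : nat} (X : nat -> {fset 'rV[R]_d}).
Variables (Fn : discrete_operator X) (F : @operator R d) (Om : set 'rV[R]_d) (eps : nat -> R).

(* A sequence of violations at times f k >= k yields a sequence xi -> 0, because
   each time is attained for finitely many k only. *)
Lemma consistent_uniform (phi : 'rV[R]_d -> R) (e : R) :
  consistent_with Fn Om eps F -> smooth phi -> 0 < e ->
  exists2 rho : R, 0 < rho & exists N, forall n t (z : X n), (N <= n)%N -> `|t| < rho ->
    inner_domain Om (eps n) (val z) ->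
    `| Fn (fun y : X n => phi (val y) + t) (phi (val z) + t) z
       - F (hess phi (val z)) (grad phi (val z)) (phi (val z)) (val z) | < e.
Proof.
move=> cons sphi e0.
pose bad n t := exists2 z : X n, inner_domain Om (eps n) (val z) &
  e <= `| Fn (fun y : X n => phi (val y) + t) (phi (val z) + t) z
       - F (hess phi (val z)) (grad phi (val z)) (phi (val z)) (val z) |.
apply: contrapT => H.
have {}H k : exists nt : nat * R, [/\ (k <= nt.1)%N, `|nt.2| < k.+1%:R^-1 & bad nt.1 nt.2].
  apply: contrapT => Hk; apply: H; exists k.+1%:R^-1; first by rewrite invr_gt0.
  exists k => n t z kn tk iz; rewrite ltNge; apply/negP => ez.
  by apply: Hk; exists (n, t); split => //; exists z.
have /choice[f Hf] := H.
(* Several [k] may share the time [n]; one of them is chosen, and [xi] is 0 at times never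
   attained. *)
pose xi n := if pselect (exists k, (f k).1 = n) is left ex then (f (projT1 (cid ex))).2 else 0.
have xi_hit k : exists2 k', (f k').1 = (f k).1 & xi (f k).1 = (f k').2.
  rewrite /xi; case: pselect => [ex|[]]; last by exists k.
  by exists (projT1 (cid ex)) => //; exact: (projT2 (cid ex)).
have xi0 : xi @ \oo --> (0 : R).
  apply/cvgrPdist_lt => r r0.
  have [m mr] : exists m : nat, m.+1%:R^-1 < r.
    have [m _ /(_ m (leqnn m))] := near_infty_natSinv_lt (PosNum r0).
    by exists m.
  (* Beyond all times attained by some [k < m], the index chosen at [n] is at least [m]. *)
  exists (\max_(k < m) (f k).1).+1 => // n /= nmax.
  rewrite sub0r normrN /xi; case: pselect => [ex|_]; last by rewrite normr0.
  move: (cid ex) => [k /= fk]; have [_ fk2 _] := Hf k.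
  have mk : (m <= k)%N.
    rewrite leqNgt; apply/negP => km; move: nmax; rewrite ltnNge -fk.
    by rewrite (leq_bigmax (Ordinal km)).
  apply: lt_le_trans fk2 _; rewrite (le_trans _ (ltW mr)) //.
  by rewrite lef_pV2 ?posrE // ler_nat.
have /cvgrPdist_lt/(_ _ e0)[N _ HN] := cons phi xi sphi xi0.
(* [N] only supplies a late time; the violation used is that of the index [k'] chosen for this time,
   whose shift is the value of [xi]. *)
have [k' fk' xik] := xi_hit N; have [Nf _ [z iz ez]] := Hf k'.
have [Nf' _ _] := Hf N.
have := HN (f N).1 Nf'; rewrite /= sub0r normrN.
have fN1 := xik; rewrite -fk' in fN1 *.
rewrite fN1 => small.
set h := (h in max_on _ h) in small.
have : h z <= max_on (inner_domain Om (eps (f k').1)) h.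
  by rewrite /max_on; apply: (@le_bigmax_cond _ _ _ _ z) => //; rewrite inE.
move=> hz; have := le_lt_trans (ler_norm _) small; rewrite ltNge => /negP; apply.
exact: le_trans hz.
Qed.

End Consistency.

(** * The subsolution property *)

Lemma continuous_pair_at (T U V : topologicalType) (f : T -> U) (g : T -> V) x :
  {for x, continuous f} -> {for x, continuous g} ->
  {for x, continuous (fun y => (f y, g y))}.
Proof. by move=> fc gc; apply: cvg_pair; [exact: fc|exact: gc]. Qed.

Lemma continuous_within_comp (T U V : topologicalType) (D : set T) (S : set U)
  (f : U -> V) (h : T -> U) :
  {within S, continuous f} -> continuous h -> (forall y, D y -> S (h y)) ->
  {within D, continuous (fun y => f (h y))}.
Proof.
move=> /subspace_continuousP fc hc DS; apply/subspace_continuousP => x Dx P fP.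
have near_hx : nbhs (h x) [set z | S z -> P (f z)] := fc _ (DS _ Dx) _ fP.
have near_x : \forall y \near x, S (h y) -> P (f (h y)) := hc _ _ near_hx.
change (\forall y \near x, D y -> P (f (h y))).
by near=> y => Dy; apply: (near near_x y) => //; exact: DS.
Unshelve. all: by end_near. Qed.

Section Subsolution.
Context {R : realType} {d : nat} (X : nat -> {fset 'rV[R]_d}).
Variables (Om : set 'rV[R]_d) (F : @operator R d) (g : 'rV[R]_d -> R).
Variables (Fn : discrete_operator X) (eps : nat -> R).

(** Symmetry of the Hessian keeps the arguments in the set on which [F] is assumed continuous. *)
Lemma operator_near_gt (psi : 'rV[R]_d -> R) x0 (a : R) :
  continuous_operator Om F -> smooth psi -> closure Om x0 ->
  a < F (hess psi x0) (grad psi x0) (psi x0) x0 ->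
  \forall y \near x0, closure Om y -> a < F (hess psi y) (grad psi y) (psi y) y.
Proof.
move=> Fc spsi Kx0 ax0; pose h y := (hess psi y, grad psi y, psi y, y).
have ch : continuous h.
  move=> x.
  have c1 : {for x, continuous (hess psi)}.
    apply: matrix_continuous_at => i j.
    rewrite (_ : (fun y => _) = partial i (partial j psi)); last first.
      by apply/funext => y; rewrite hessE.
    exact: (smooth_continuous (smooth_partial i (smooth_partial j spsi))).
  have c2 : {for x, continuous (grad psi)}.
    apply: matrix_continuous_at => i j.
    rewrite (_ : (fun y => _) = partial j psi); last by apply/funext => y; rewrite mxE.
    exact: (smooth_continuous (smooth_partial j spsi)).
  have c3 : {for x, continuous psi} by exact: (smooth_continuous spsi).
  have c4 : {for x, continuous (@id 'rV[R]_d)} by move=> P.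
  exact: continuous_pair_at (continuous_pair_at (continuous_pair_at c1 c2) c3) c4.
have hS y : closure Om y -> ((h y).1.1.1^T = (h y).1.1.1)%R /\ closure Om (h y).2.
  by move=> Ky; split => //=; exact: hess_sym.
have /subspace_continuousP/(_ _ Kx0) Fhc := continuous_within_comp Fc ch hS.
exact: (cvgr_gt _ Fhc _ ax0).
Qed.

Variables (u : forall n, X n -> R) (C : R).
Hypothesis closure_compact : compact (closure Om).
Hypothesis X_sub : forall n (z : X n), Om (val z).
Hypothesis X_dense : dense_in_limit X (closure Om).
Hypothesis u_bounded : forall n (z : X n), `|u z| <= C.
Hypothesis F_cont : continuous_operator Om F.
Hypothesis g_cont : {within closure Om, continuous g}.
Hypothesis Fn_monotone : monotone_operator Fn.
Hypothesis Fn_consistent : consistent_with Fn Om eps F.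
Hypothesis u_solution : discrete_solution Fn Om g eps u.
Hypothesis layer_far : forall x, Om x ->
  \forall y \near x & n \near \oo, ~ boundary_layer Om (eps n) y.

(* Where the operator is positive at the touching point, monotonicity and
   consistency force the maximum points of u n - psi into the boundary layer. *)
Lemma maximum_points_in_layer (psi : 'rV[R]_d -> R) x0 :
  smooth psi -> closure Om x0 -> upper_limit u x0 = psi x0 ->
  (forall y, closure Om y -> upper_limit u y <= psi y - `|x0 - y| ^+ 4) ->
  0 < F (hess psi x0) (grad psi x0) (psi x0) x0 ->
  forall (delta : R) N, 0 < delta ->
  exists n (z : X n), [/\ (N <= n)%N, `|x0 - val z| < delta,
    `|u z - psi (val z)| < delta & boundary_layer Om (eps n) (val z)].
Proof.
move=> spsi Kx0 upsi psi_touch; set A := F _ _ _ _ => A0 delta N d0.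
have A2 : 0 < A / 2 by rewrite divr_gt0.
(* The positive value [A] is halved: near [x0] the operator stays above [A / 2], while the
   consistency error is below [A / 2]. *)
have [|r /= r0 Hr] := (nbhs_ballP _ _).1 (@operator_near_gt psi x0 (A / 2) F_cont spsi Kx0 _).
  by rewrite -/A ltr_pdivrMr // ltr_pMr // ltr1n.
have [rho rho0 [M HM]] := consistent_uniform Fn_consistent spsi A2.
pose dl := Num.min delta (Num.min r rho).
have dl0 : 0 < dl by rewrite !lt_min d0 r0 rho0.
have XK n (z : X n) : closure Om (val z) by apply: subset_closure; exact: X_sub.
have [n [z [Nn xz uz utouch]]] := maximum_points_cvg X_dense u_bounded closure_compact
  XK (smooth_continuous spsi) Kx0 upsi psi_touch (maxn N M) dl0.
move: xz uz; rewrite !lt_min => /and3P[xz1 xz2 xz3] /and3P[uz1 uz2 uz3].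
exists n, z; split => //; first exact: leq_trans (leq_maxl _ _) Nn.
have [//|nlayer] := pselect (boundary_layer Om (eps n) (val z)).
have inner : inner_domain Om (eps n) (val z) by split; [exact: X_sub|].
have Fz : A / 2 < F (hess psi (val z)) (grad psi (val z)) (psi (val z)) (val z).
  by apply: Hr => //; rewrite -ball_normE.
have := HM n _ z (leq_trans (leq_maxr _ _) Nn) uz3 inner.
have Feq : psi (val z) + (u z - psi (val z)) = u z by rewrite addrC subrK.
rewrite Feq.
have Fn0 := (u_solution z).1 inner.
(* The shifted [psi] lies above [u] and agrees with it at [z], so monotonicity makes the scheme
   nonpositive on it, whereas consistency makes it positive. *)
have := Fn_monotone (u z) z utouch; rewrite Fn0 => Fle.
by rewrite ltr_norml => /andP[+ _]; lra.
Qed.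

Lemma upper_limit_subsolution : visc_subsolution Om F g (upper_limit u).
Proof.
split; first exact: upper_limit_usc X_dense u_bounded.
move=> x0 phi Kx0 sphi locmax.
have [psi [spsi psix0 <- <- psi_touch]] := global_test_function closure_compact Kx0
  (upper_limit_bounded X_dense u_bounded) sphi locmax.
rewrite -psix0.
(* If the operator is nonpositive, both the interior and the boundary condition hold at once. *)
have [A0|A0] := leP (F (hess psi x0) (grad psi x0) (psi x0) x0) 0.
  by split => // _; rewrite ge_min A0.
have layer := maximum_points_in_layer spsi Kx0 (esym psix0) psi_touch A0.
split.
  move=> Omx0; have [[U V] /= [Ux0 [N _ NV]] UV] := layer_far Omx0.
  have [r /= r0 Hr] := (nbhs_ballP _ _).1 Ux0.
  have [n [z [Nn xz _ lz]]] := layer r N r0.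
  exfalso; apply: (UV (val z, n)) lz; split => /=; last exact: NV.
  by apply: Hr; rewrite -ball_normE.
move=> _; rewrite ge_min; apply/orP; right; rewrite leNgt; apply/negP => e0.
(* Three errors of [e / 4] occur: in [g], in [psi] and between [u] and [psi]. As [u = g] in the
   layer, they would give [e < 3 * e / 4]. *)
set e := psi x0 - g x0 in e0; have e4 : 0 < e / 4 by rewrite divr_gt0.
have gx0 : \forall y \near x0, closure Om y -> g y < g x0 + e / 4.
  have /subspace_continuousP/(_ _ Kx0) gc := g_cont.
  by apply: (cvgr_lt _ gc); rewrite ltrDl.
have px0 : \forall y \near x0, psi x0 - e / 4 < psi y.
  by apply: (cvgr_gt _ (smooth_continuous spsi (x := x0))); rewrite ltrBlDr ltrDl.
have [r /= r0 Hr] := (nbhs_ballP _ _).1 (filterI gx0 px0).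
have [|n [z [_ xz uz lz]]] := layer (Num.min r (e / 4)) 0%N; first by rewrite lt_min r0.
move: xz uz; rewrite !lt_min => /andP[xz _] /andP[_ uz].
have [|gz pz] := Hr (val z); first by rewrite -ball_normE.
have Kz : closure Om (val z) by apply: subset_closure; exact: X_sub.
have := gz Kz; rewrite -((u_solution z).2 lz).
by move: uz pz e0; rewrite ltr_norml /= /e => /andP[+ _]; lra.
Qed.

End Subsolution.

(** * Duality between sub- and supersolutions *)

Lemma opp_triple_continuous (R : realType) (U V W : normedModType R) (T : topologicalType) :
  continuous (fun z : U * V * W * T => (- z.1.1.1, - z.1.1.2, - z.1.2, z.2)).
Proof.
move=> z.
have c1 : {for z, continuous (fun z : U * V * W * T => z.1)} by exact: cvg_fst.
have c11 : {for z, continuous (fun z : U * V * W * T => z.1.1)}.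
  by apply: (continuous_comp c1); exact: cvg_fst.
have c111 : {for z, continuous (fun z : U * V * W * T => z.1.1.1)}.
  by apply: (continuous_comp c11); exact: cvg_fst.
have c112 : {for z, continuous (fun z : U * V * W * T => z.1.1.2)}.
  by apply: (continuous_comp c11); exact: cvg_snd.
have c12 : {for z, continuous (fun z : U * V * W * T => z.1.2)}.
  by apply: (continuous_comp c1); exact: cvg_snd.
have c2 : {for z, continuous (fun z : U * V * W * T => z.2)} by exact: cvg_snd.
have n1 : {for z, continuous (fun z : U * V * W * T => - z.1.1.1)} by exact: cvgN c111.
have n2 : {for z, continuous (fun z : U * V * W * T => - z.1.1.2)} by exact: cvgN c112.
have n3 : {for z, continuous (fun z : U * V * W * T => - z.1.2)} by exact: cvgN c12.
exact: continuous_pair_at (continuous_pair_at (continuous_pair_at n1 n2) n3) c2.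
Qed.

Section Duality.
Context {R : realType} {d : nat} (X : nat -> {fset 'rV[R]_d}).
Implicit Types (Om : set 'rV[R]_d) (F : @operator R d) (g w : 'rV[R]_d -> R).

(* w is a subsolution for (dual_operator F, - g) iff - w is a supersolution for
   (F, g). *)
Definition dual_operator F : @operator R d := fun p q r x => - F (- p) (- q) (- r) x.

(** The scheme solved by the negatives of the solutions of [Fn]. *)
Definition dual_scheme (Fn : discrete_operator X) : discrete_operator X :=
  fun n u t x => - Fn n (fun y => - u y) (- t) x.

Lemma dual_operator_continuous Om F :
  continuous_operator Om F -> continuous_operator Om (dual_operator F).
Proof.
move=> Fc.
have ch := @opp_triple_continuous R 'M[R]_d 'rV[R]_d R 'rV[R]_d.
pose S : set ('M[R]_d * 'rV[R]_d * R * 'rV[R]_d) :=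
  [set z | (z.1.1.1^T = z.1.1.1)%R /\ closure Om z.2].
have hS z : S z -> S (- z.1.1.1, - z.1.1.2, - z.1.2, z.2).
  by move=> [zsym Kz]; split => //=; rewrite linearN /= zsym.
have /subspace_continuousP FNc := continuous_within_comp Fc ch hS.
by apply/subspace_continuousP => z Sz; exact: (cvgN (FNc z Sz)).
Qed.

Lemma dual_scheme_monotone (Fn : discrete_operator X) :
  monotone_operator Fn -> monotone_operator (dual_scheme Fn).
Proof. by move=> mono n u v t x uv; rewrite lerN2; apply: mono => y; rewrite lerN2. Qed.

(** Consistency of [Fn] is applied to [- phi] and [- xi]; the errors agree in absolute value. *)
Lemma dual_scheme_consistent (Fn : discrete_operator X) Om eps F :
  consistent_with Fn Om eps F ->
  consistent_with (dual_scheme Fn) Om eps (dual_operator F).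
Proof.
move=> cons phi xi sphi xi0.
have Nxi0 : - xi @ \oo --> (0 : R) by rewrite -oppr0; exact: cvgN.
have := cons _ _ (smoothN sphi) Nxi0; apply: cvg_trans; apply: near_eq_cvg.
have normNN (a b : R) : `|- a - - b| = `|a - b| by rewrite -opprD normrN.
near=> n; apply: eq_bigr => x _; rewrite /dual_scheme /dual_operator normNN.
rewrite (hessN _ sphi) (gradN _ sphi) [- (phi _ + _)]opprD.
rewrite (_ : (fun y : X n => - (phi (val y) + xi n)) =
             (fun y : X n => - phi (val y) + (- xi) n)) //.
by apply/funext => y; rewrite opprD.
Unshelve. all: by end_near. Qed.

Lemma dual_discrete_solution (Fn : discrete_operator X) Om g eps (u : forall n, X n -> R) :
  discrete_solution Fn Om g eps u ->
  discrete_solution (dual_scheme Fn) Om (fun y => - g y) eps (fun n z => - u n z).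
Proof.
move=> sol n x; have [inner layer] := sol n x; split => [/inner F0|/layer -> //].
rewrite /dual_scheme opprK (_ : (fun y => _) = u n) ?F0 ?oppr0 //.
by apply/funext => y; rewrite opprK.
Qed.

Lemma dual_subsolution Om F g w :
  visc_subsolution Om (dual_operator F) (fun y => - g y) w ->
  visc_supersolution Om F g (fun y => - w y).
Proof.
move=> [wusc wsub]; split.
  move=> x Kx a; rewrite ltrNr => /(wusc x Kx); apply: filterS => y.
  by rewrite ltrNr.
move=> x phi Kx sphi locmin.
have [] := wsub x (fun y => - phi y) Kx (smoothN sphi).
  by apply: filterS locmin => y; rewrite -!opprD lerN2 !opprK.
rewrite /dual_operator (hessN _ sphi) (gradN _ sphi) !opprK => inside bdry.
split => [/inside|/bdry]; first by rewrite oppr_le0.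
by rewrite ge_min le_max oppr_le0 -opprD oppr_ge0.
Qed.

(** Semicontinuity and extrema are taken within the closure. This is needed because the two relaxed
    limits are only compared there. *)
Lemma supersolution_eq_on Om F g (v w : 'rV[R]_d -> R) :
  (forall x, closure Om x -> v x = w x) ->
  visc_supersolution Om F g v -> visc_supersolution Om F g w.
Proof.
move=> vw [vlsc vsup]; split.
  move=> x Kx a; rewrite -vw // => /(vlsc x Kx a).
  by rewrite !near_withinE; apply: filterS => y + Ky; rewrite -vw //; exact.
move=> x phi Kx sphi locmin; rewrite -vw //; apply: vsup => //.
move: locmin; rewrite /loc_min_on !near_withinE.
by apply: filterS => y + Ky; rewrite -!vw //; exact.
Qed.

End Duality.

(** * Geometry of the domain and of the point sets *)

Section Geometry.
Context {R : realType} {d : nat}.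
Implicit Types (x y : 'rV[R]_d) (A Om : set 'rV[R]_d).

Lemma mx_norm_le_edist x y : `|x - y| <= Defs.edist x y.
Proof.
have E : `|x - y| = mx_norm (x - y) by [].
have [nz|nz] := eqVneq (mx_norm (x - y)) 0.
  by rewrite E nz sqrtr_ge0.
have [[l i] /= xyi] := mx_norm_neq0 nz; rewrite E xyi -sqrtr_sqr ler_wsqrtr //.
rewrite (bigD1 i) //= (ord1 l) !mxE ler_wpDr // sumr_ge0 // => j _.
exact: sqr_ge0.
Qed.

Lemma edist_le x y (M : R) : `|x - y| <= M -> Defs.edist x y <= Num.sqrt (\sum_(i < d) M ^+ 2).
Proof.
move=> xyM; rewrite ler_wsqrtr //; apply: ler_sum => i _.
have Mi : `|x 0 i - y 0 i| <= M.
  have E : `|x - y| = mx_norm (x - y) by [].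
  apply: le_trans xyM; rewrite E mx_normrE.
  by apply/bigmax_geP; right => /=; exists (0, i); rewrite ?mxE.
by rewrite -real_normK ?num_real // lerXn2r // nnegrE // (le_trans _ Mi).
Qed.

Lemma edist_set_lt x A (r : R) : A !=set0 -> edist_set x A < r ->
  exists2 y, A y & Defs.edist x y < r.
Proof.
move=> [a Aa] /inf_lt[|_ [y Ay <-] yr]; last by exists y.
by exists (Defs.edist x a); exists a.
Qed.

Lemma edist_set_le x y A : A y -> edist_set x A <= Defs.edist x y.
Proof.
move=> Ay; apply: ge_inf; last by exists y.
by exists 0 => _ [z _ <-]; exact: sqrtr_ge0.
Qed.

(** A ball of radius [r] inside the open set misses the boundary, so points of the ball of radius
    [r / 2] are not within [eps n < r / 2] of it. *)
Lemma boundary_layer_far Om (eps : nat -> R) x : open Om -> boundary Om !=set0 ->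
  eps @ \oo --> (0 : R) -> Om x ->
  \forall y \near x & n \near \oo, ~ boundary_layer Om (eps n) y.
Proof.
move=> oOm bd0 eps0 Omx.
have /nbhs_ballP[r /= r0 Hr] := open_nbhs_nbhs (conj oOm Omx).
have r2 : 0 < r / 2 by rewrite divr_gt0.
have epsr : \forall n \near \oo, eps n < r / 2 by exact: (cvgr_lt _ eps0 _ r2).
exists (ball x (r / 2), [set n | eps n < r / 2]) => /=.
  by split => //; exact: nbhsx_ballx.
move=> [y n] /= [xy en] [_ yl].
have [b [bc bi] yb] := edist_set_lt bd0 (le_lt_trans yl en).
apply: bi; have -> : Om° = Om by exact/interior_id.
apply: Hr.
rewrite [r]splitr; apply: ball_triangle xy _.
by rewrite -ball_normE /=; apply: le_lt_trans yb; exact: mx_norm_le_edist.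
Qed.

Lemma bounded_closure Om : bounded_set Om -> bounded_set (closure Om).
Proof.
move=> [M [Mreal HM]]; exists (M + 2); split; first exact: num_real.
move=> N MN x clx.
have [y [Omy xy]] := clx _ (nbhsx_ballx x 1 ltr01).
have yM : `|y| <= M + 1 by apply: HM => //; rewrite ltrDl.
move: xy; rewrite -ball_normE /= => xy.
rewrite -[x](subrK y) (le_trans (ler_normD _ _)) //.
by move: MN yM xy; lra.
Qed.

(** A point of the closure maximising one coordinate cannot be interior, since a small step in that
    direction would increase the coordinate. *)
Lemma boundary_nonempty Om : (0 < d)%N -> bounded_set Om -> Om !=set0 ->
  boundary Om !=set0.
Proof.
move=> d0 bOm [x Omx]; pose i0 := Ordinal d0.
have cK : compact (closure Om).
  by apply: bounded_closed_compact; [exact: bounded_closure|exact: closed_closure].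
have K0 : closure Om !=set0 by exists x; exact: subset_closure.
have cf : {within closure Om, continuous (fun y : 'rV[R]_d => y 0 i0)}.
  by apply: continuous_subspaceT; exact: coord_continuous.
have [a Ka amax] := compact_EVT_max K0 cK cf.
exists a; split; first by move: Ka; rewrite inE.
move=> /nbhs_ballP[r /= r0 Hr].
pose e : 'rV[R]_d := delta_mx 0 i0.
pose t := r / (`|e| + 1).
have e1 : 0 < `|e| + 1 by rewrite ltr_wpDl.
have t0 : 0 < t by rewrite divr_gt0.
have Om_ate : Om (a + t *: e).
  apply: Hr; rewrite -ball_normE /= opprD addNKr normrN normrZ gtr0_norm //.
  by rewrite mulrAC ltr_pdivrMr // ltr_pM2l // ltrDl.
have := amax (a + t *: e); rewrite inE => /(_ (subset_closure Om_ate)).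
by rewrite !mxE !eqxx mulr1 gerDl leNgt t0.
Qed.

Lemma space_filling_dense (X : nat -> {fset 'rV[R]_d}) Om : bounded_set Om ->
  (forall n, (0 < n)%N -> [set` X n] !=set0) -> space_filling X Om ->
  (forall n, [set` X n] `<=` Om) -> dense_in_limit X (closure Om).
Proof.
move=> [M [_ HM]] X0 Xfill XOm x Kx U /nbhs_ballP[r /= r0 Hr].
have OmM w : Om w -> `|w| <= M + 1 by move=> Omw; apply: HM => //; rewrite ltrDl.
have r2 : 0 < r / 2 by rewrite divr_gt0.
have [y [Omy xy]] := Kx _ (nbhsx_ballx x (r / 2) r2).
have fill : \forall n \near \oo,
  sup [set edist_set x [set` X n] | x in Om] < r / 2 by exact: (cvgr_lt _ Xfill _ r2).
near=> n.
have n0 : (0 < n)%N by near: n; exact: nbhs_infty_gt.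
have [z Xz yz] : exists2 z, z \in X n & Defs.edist y z < r / 2.
  apply: (@edist_set_lt y [set` X n]); first exact: X0.
  apply: (@le_lt_trans _ _ (sup [set edist_set x [set` X n] | x in Om])); last by near: n.
  apply: ub_le_sup; last by exists y.
  have [z0 Xz0] := X0 n n0.
  (* A real supremum bounds its members only if the set is bounded above; this constant bounds the
     distance of two points of [Om], each of sup norm at most [M + 1]. *)
  exists (Num.sqrt (\sum_(i < d) (M + 1 + (M + 1)) ^+ 2)) => _ [y' Omy' <-].
  apply: le_trans (edist_set_le _ Xz0) _; apply: edist_le.
  rewrite (le_trans (ler_normB _ _)) // lerD //; first exact: OmM.
  exact/OmM/(XOm _ _ Xz0).
exists [` Xz]%fset; apply: Hr => /=; rewrite [r]splitr; apply: ball_triangle xy _.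
by rewrite -ball_normE /=; apply: le_lt_trans yz; exact: mx_norm_le_edist.
Unshelve. all: by end_near. Qed.

End Geometry.

(** * Convergence *)

(** The lower relaxed limit is below the upper one: bounds [a] for [u] and [b] for [- u] apply to a
    common late grid point near [x], so [- b <= a]. *)
Lemma opp_upper_limit_opp_le (R : realType) (d : nat) (X : nat -> {fset 'rV[R]_d})
  (K : set 'rV[R]_d) (u : forall n, X n -> R) (C : R) x :
  dense_in_limit X K -> (forall n (z : X n), `|u n z| <= C) -> K x ->
  - upper_limit (fun n z => - u n z) x <= upper_limit u x.
Proof.
move=> Xd uC Kx.
have NuC n (z : X n) : `|- u n z| <= C by rewrite normrN.
have [ne _] := eventual_upper_bound_has_inf Xd uC Kx.
have [Nne _] := eventual_upper_bound_has_inf Xd NuC Kx.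
apply: lb_le_inf => // a [[U1 V1] /= [Ux1 [N1 _ NV1]] UV1].
rewrite lerNl; apply: lb_le_inf => // b [[U2 V2] /= [Ux2 [N2 _ NV2]] UV2].
have [N3 _ HN3] := Xd x Kx _ (filterI Ux1 Ux2).
pose n := maxn N1 (maxn N2 N3).
have [z [U1z U2z]] : exists z : X n, (U1 `&` U2) (val z).
  by apply: HN3; rewrite /= /n !leq_max leqnn !orbT.
have ua : u n z <= a.
  by apply: (UV1 (val z, n)) => //; split => //; apply: NV1; rewrite /= leq_maxl.
have ub : - u n z <= b.
  apply: (UV2 (val z, n)) => //; split => //; apply: NV2.
  by rewrite /= /n !leq_max leqnn orbT.
by move: ua ub; lra.
Qed.

Lemma usc_lsc_continuous (R : realType) (d : nat) (K : set 'rV[R]_d) (w : 'rV[R]_d -> R) :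
  usc_on K w -> lsc_on K w -> {within K, continuous w}.
Proof.
move=> wusc wlsc; apply/subspace_continuousP => x Kx; apply/cvgrPdist_lt => e e0.
have H1 : \forall y \near within K (nbhs x), w y < w x + e by apply: wusc => //; rewrite ltrDl.
have H2 : \forall y \near within K (nbhs x), w x - e < w y.
  by apply: wlsc => //; rewrite ltrBlDr ltrDl.
apply: filterS2 H1 H2 => y lt1 gt1; change (`|w x - w y| < e).
by rewrite ltr_norml; apply/andP; split; lra.
Qed.

(* X 0 is empty, so the index n = 0 carries no information. *)
Theorem theorem2p23 (R : realType) (d : nat)
  (Om : set 'rV[R]_d) (Om_open : open Om) (Om_bounded : bounded_set Om)
  (X : nat -> {fset 'rV[R]_d})
  (X_card : forall n, #|` X n| = n)
  (X_sub : forall n, [set` X n] `<=` Om)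
  (eps : nat -> R) (eps_gt0 : forall n, (1 <= n)%N -> 0 < eps n)
  (Fn : discrete_operator X)
  (F : operator) (F_cont : continuous_operator Om F)
  (g : 'rV[R]_d -> R) (g_cont : {within closure Om, continuous g})
  (P_strong_uniqueness : strong_uniqueness Om F g)
  (Fn_monotone : monotone_operator Fn)
  (Fn_proper : proper_operator Fn)
  (Fn_consistent : consistent_with Fn Om eps F)
  (X_space_filling : space_filling X Om)
  (eps_cvg0 : eps @ \oo --> (0 : R))
  (un : forall n, X n -> R)
  (un_solution : discrete_solution Fn Om g eps un)
  (un_bounded : exists C : R, 0 < C /\
     forall n, (1 <= n)%N -> max_on setT (fun x : X n => `|un n x|) <= C) :
  exists u : 'rV[R]_d -> R,
    [/\ {within closure Om, continuous u},
        visc_solution Om F g u,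
        (forall v, visc_solution Om F g v ->
           forall x, closure Om x -> v x = u x) &
        (fun n => max_on setT (fun x : X n => `|un n x - u (val x)|))
          @ \oo --> (0 : R)].

Proof.
have X_pos n (z : X n) : (0 < n)%N.
  rewrite -(X_card n) cardfs_gt0; apply/fset0Pn; exists (val z); exact: valP.
have X_nonempty n : (0 < n)%N -> [set` X n] !=set0.
  move=> n0; have /fset0Pn[z Xz] : X n != fset0 by rewrite -cardfs_gt0 X_card.
  by exists z.
(* In dimension 0 the space is a single point and cannot contain the two points of [X 2]. *)
have d_gt0 : (0 < d)%N.
  rewrite lt0n; apply/eqP => d0.
  have : (X 2%N `<=` [fset (0 : 'rV[R]_d)])%fset.
    apply/fsubsetP => z _; rewrite inE; apply/eqP/rowP => i.
    by have := ltn_ord i; rewrite [X in (_ < X)%N]d0.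
  by move=> /fsubset_leq_card; rewrite X_card cardfs1.
have Om_nonempty : Om !=set0.
  by have [z Xz] := X_nonempty 1%N isT; exists z; exact: (X_sub 1%N).
have bd_nonempty := boundary_nonempty d_gt0 Om_bounded Om_nonempty.
have X_in n (z : X n) : Om (val z) by apply: (X_sub n); exact: valP.
have X_closure n (z : X n) : closure Om (val z) by exact: subset_closure.
have cK : compact (closure Om).
  by apply: bounded_closed_compact; [exact: bounded_closure|exact: closed_closure].
have Xd := space_filling_dense Om_bounded X_nonempty X_space_filling X_sub.
have far x : Om x -> _ := @boundary_layer_far R d Om eps x Om_open bd_nonempty eps_cvg0.
have [C [_ HC]] := un_bounded.
have uC n (z : X n) : `|un n z| <= C.
  apply: le_trans (HC n (X_pos n z)).
  by apply: (@le_bigmax_cond _ _ _ _ z); rewrite inE.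
have NuC n (z : X n) : `|- un n z| <= C by rewrite normrN.
pose u := upper_limit un; pose v := upper_limit (fun n z => - un n z).
have usub : visc_subsolution Om F g u.
  exact: (upper_limit_subsolution cK X_in Xd uC F_cont g_cont Fn_monotone Fn_consistent
    un_solution far).
have Ng_cont : {within closure Om, continuous (fun y => - g y)}.
  by move=> x; exact: (cvgN (g_cont x)).
have vsuper : visc_supersolution Om F g (fun y => - v y).
  apply: dual_subsolution.
  exact: (upper_limit_subsolution cK X_in Xd NuC (dual_operator_continuous F_cont) Ng_cont
    (dual_scheme_monotone Fn_monotone) (dual_scheme_consistent Fn_consistent)
    (dual_discrete_solution un_solution) far).
(* One inequality compares the relaxed limits directly, the other is strong uniqueness. *)
have uv x : closure Om x -> - v x = u x.
  move=> Kx; apply/le_anti/andP; split; last exact: P_strong_uniqueness usub vsuper x Kx.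
  exact: (opp_upper_limit_opp_le Xd uC Kx).
have usuper : visc_supersolution Om F g u := supersolution_eq_on uv vsuper.
have u_cont := usc_lsc_continuous usub.1 usuper.1.
exists u; split => //.
  move=> w [wsub wsuper] x Kx; apply/le_anti.
  by rewrite (P_strong_uniqueness _ _ wsub usuper) // (P_strong_uniqueness _ _ usub wsuper).
apply/cvgrPdist_lt => e e0; have e2 : 0 < e / 2 by rewrite divr_gt0.
have above : \forall n \near \oo, forall z : X n, un n z < u (val z) + e / 2.
  apply: (@upper_limit_lt_uniform _ _ _ _ _ _ Xd uC (fun y => u y + e / 2) cK X_closure).
    move=> x Kx a ax; have := usuper.1 x Kx (a - e / 2); rewrite ltrBlDr => /(_ ax).
    by apply: filterS => y; rewrite ltrBlDr.
  by move=> x Kx; rewrite ltrDl.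
(* The same compactness argument for the negated functions, whose upper limit [v] equals [- u] on
   the closure. *)
have below : \forall n \near \oo, forall z : X n, - un n z < - u (val z) + e / 2.
  apply: (@upper_limit_lt_uniform _ _ _ _ _ _ Xd NuC (fun y => - u y + e / 2) cK X_closure).
    move=> x Kx a ax; have := usub.1 x Kx (e / 2 - a); rewrite ltrBrDl -ltrBrDr => H.
    have {}H : \forall y \near within (closure Om) (nbhs x), u y < e / 2 - a.
      by apply: H; move: ax; lra.
    by apply: filterS H => y; lra.
  by move=> x Kx; rewrite -(uv x Kx) opprK ltrDl.
(* The default 0 of the maximum makes it nonnegative, and [0 <= e / 2] covers this default when
   bounding it. *)
near=> n; rewrite sub0r normrN ger0_norm; last exact: bigmax_ge_id.
apply: (@le_lt_trans _ _ (e / 2)); last by move: e0; lra.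
apply: bigmax_le => [|z _]; first exact: ltW.
have zab : un n z < u (val z) + e / 2 by move: z; near: n.
have zbe : - un n z < - u (val z) + e / 2 by move: z {zab}; near: n.
by rewrite ler_norml; move: zab zbe; lra.
Unshelve. all: by end_near. Qed.
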